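(* Let $\Gamma$ be a group and let $\rho_1,\rho_2:\Gamma\to H=\mathrm{Homeo}^+(S^1)$ be circle actions. Then the following are equivalent: (i) $\rho_1$ is both left-semi-conjugate and right-semi-conjugate to $\rho_2$. (ii) Either neither $\rho_1(\Gamma)$ nor $\rho_2(\Gamma)$ has a global fixed point in $S^1$ and $\rho_1$ is left-semi-conjugate to $\rho_2$, or $\rho_1(\Gamma)$ and $\rho_2(\Gamma)$ both have a global fixed point in $S^1$. (iii) There exist a left-semi-conjugacy $\varphi$ from $\rho_1$ to $\rho_2$ and a non-empty $\rho_2(\Gamma)$-invariant subset $K\subset S^1$ such that $\varphi|_K$ is injective. (iv) There exist a left-semi-conjugacy $\varphi$ from $\rho_1$ to $\rho_2$, lifts $\widetilde{\rho_1}(\gamma),\widetilde{\rho_2}(\gamma)\in\widetilde H$ of $\rho_1(\gamma),\rho_2(\gamma)$ for each $\gamma\in\Gamma$, and a good lift $\widetilde\varphi$ of $\varphi$ such that $\widetilde{\rho_1}(\gamma)\widetilde\varphi(x)=\widetilde\varphi(\widetilde{\rho_2}(\gamma)(x))$ for all $\gamma\in\Gamma$ and $x\in\mathbb{R}$. (v) $\rho_1$ and $\rho_2$ have the same bounded Euler class, i.e. $\rho_1^*\mathrm{eu}_b=\rho_2^*\mathrm{eu}_b\in H^2_b(\Gamma;\mathbb{Z})$. Moreover, all of these conditions remain equivalent if the left-semi-conjugacies in question are required to be upper semi-continuous, and likewise if they are required to be lower semi-continuous.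
   Context: $S^1=\mathbb{R}/\mathbb{Z}$; $H=\mathrm{Homeo}^+(S^1)$ is the group of orientation-preserving homeomorphisms of $S^1$. A circle action of a group $\Gamma$ is a homomorphism $\rho:\Gamma\to H$. A global fixed point of $\rho(\Gamma)$ is a point $x\in S^1$ with $\rho(\gamma)(x)=x$ for all $\gamma\in\Gamma$. A map $\varphi:S^1\to S^1$ (not necessarily continuous) is a non-decreasing degree one map if it has a good lift, i.e. a set-theoretic lift $\widetilde\varphi:\mathbb{R}\to\mathbb{R}$ with $\widetilde\varphi(x+1)=\widetilde\varphi(x)+1$ for all $x$ and $\widetilde\varphi(x)\le\widetilde\varphi(y)$ whenever $x\le y$. It is called upper (resp. lower) semi-continuous if it admits an upper (resp. lower) semicontinuous good lift. A left-semi-conjugacy from $\rho_1$ to $\rho_2$ is a non-decreasing degree one map $\varphi$ with $\rho_1(\gamma)\varphi=\varphi\rho_2(\gamma)$ for all $\gamma\in\Gamma$; if one exists, $\rho_1$ is left-semi-conjugate to $\rho_2$ and $\rho_2$ is right-semi-conjugate to $\rho_1$. $\widetilde H=\{\widetilde h\in\mathrm{Homeo}^+(\mathbb{R}): \widetilde h(x+1)=\widetilde h(x)+1\ \forall x\}$, with central extension $0\to\mathbb{Z}\xrightarrow{i}\widetilde H\xrightarrow{p}H\to\{e\}$, $i(n)(x)=x+n$, $p(\widetilde h)([x])=[\widetilde h(x)]$. Bounded Euler class: $H^2_b(G;\mathbb{Z})$ is the second bounded cohomology of the (discrete) group $G$, computed from bounded inhomogeneous cochains $G^n\to\mathbb{Z}$.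 Let $\sigma:H\to\widetilde H$ be a set-theoretic section of $p$ with $\{\sigma(h)(0):h\in H\}$ bounded (e.g. $\sigma(h)(0)\in[0,1)$ for all $h$), and define the bounded cocycle $c_\sigma:H^2\to\mathbb{Z}$ by $\sigma(h_1)\sigma(h_2)=\sigma(h_1h_2)\,i(c_\sigma(h_1,h_2))$. Then $\mathrm{eu}_b:=[c_\sigma]\in H^2_b(H;\mathbb{Z})$, which is independent of the choice of bounded section. The bounded Euler class of a circle action $\rho$ is $\rho^*\mathrm{eu}_b\in H^2_b(\Gamma;\mathbb{Z})$. *)

(* Defs.v *)
From HB Require Import structures.
From mathcomp Require Import all_boot all_order all_algebra.
From mathcomp Require Import all_classical all_reals all_analysis.
From mathcomp Require Import lra.

Set Implicit Arguments.
Unset Strict Implicit.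
Unset Printing Implicit Defensive.

Import Order.TTheory GRing.Theory Num.Theory.
Import numFieldNormedType.Exports.

Local Open Scope classical_set_scope.
Local Open Scope quotient_scope.
Local Open Scope ring_scope.

Definition is_homeo {T U : topologicalType} (f : T -> U) : Prop :=
  continuous f /\ exists g : U -> T, [/\ continuous g, cancel f g & cancel g f].

Lemma is_homeo_id {T : topologicalType} : is_homeo (@id T).
Proof. by split; [|exists id; split] => // x; exact: cvg_id. Qed.

Lemma is_homeo_comp {T U V : topologicalType} (f : U -> V) (g : T -> U) :
  is_homeo f -> is_homeo g -> is_homeo (f \o g).
Proof.
move=> [cf [f' [cf' fK f'K]]] [cg [g' [cg' gK g'K]]]; split.
  by move=> x; apply: continuous_comp; [exact: cg|exact: cf].
exists (g' \o f'); split.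
- by move=> x; apply: continuous_comp; [exact: cf'|exact: cg'].
- exact: can_comp.
- exact: can_comp.
Qed.

Definition homeo_inv {T U : topologicalType} (f : T -> U) (hf : is_homeo f) :
  U -> T := sval (cid hf.2).

Section homeo_inv.
Context {T U : topologicalType} (f : T -> U) (hf : is_homeo f).

Lemma homeo_invK : cancel f (homeo_inv hf).
Proof. by rewrite /homeo_inv; case: cid => g []. Qed.

Lemma homeo_invKV : cancel (homeo_inv hf) f.
Proof. by rewrite /homeo_inv; case: cid => g []. Qed.

Lemma is_homeo_inv : is_homeo (homeo_inv hf).
Proof.
split; first by rewrite /homeo_inv; case: cid => g [].
by exists f; split; [exact: hf.1|exact: homeo_invKV|exact: homeo_invK].
Qed.

End homeo_inv.

(* [x \in integers R] is [x \is a Num.int]. *)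
Definition integers (R : realType) : zmodClosed R :=
  GRing.ZmodClosed.clone R (@Num.int_num_subdef R) _.

Definition circle (R : realType) : Type :=
  quotient_topology (Quotient.quot (integers R)).

HB.instance Definition _ (R : realType) :=
  Topological.copy (circle R) (quotient_topology (Quotient.quot (integers R))).
HB.instance Definition _ (R : realType) :=
  Quotient.copy (circle R) (quotient_topology (Quotient.quot (integers R))).

Definition circle_pi {R : realType} (x : R) : circle R := \pi_(circle R) x.

Lemma circle_piP {R : realType} (x y : R) :
  circle_pi x = circle_pi y <-> exists n : int, x = y + n%:~R.
Proof.
rewrite /circle_pi -[_ = _]/(x = y %[mod Quotient.quot (integers R)]).
rewrite (rwP eqP) -Quotient.idealrBE; split=> [/intrP[n xyn]|[n ->]].
  by exists n; rewrite -xyn addrC subrK.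
by rewrite addrC addKr; apply/intrP; exists n.
Qed.

Lemma circle_pi_surj {R : realType} (z : circle R) : exists x, circle_pi x = z.
Proof. by exists (repr z); exact: reprK. Qed.

Lemma circle_continuous {R : realType} {Z : topologicalType} (f : circle R -> Z) :
  continuous (f \o circle_pi) -> continuous f.
Proof. by move=> h; apply/quotient_continuous. Qed.

Lemma circle_pi_continuous {R : realType} : continuous (@circle_pi R).
Proof. exact: pi_continuous. Qed.

Section degree_one.
Context {R : realType}.
Implicit Types (phi : circle R -> circle R) (f : R -> R).

Definition good_lift phi f : Prop :=
  [/\ forall x, circle_pi (f x) = phi (circle_pi x),
      forall x, f (x + 1) = f x + 1 &
      {homo f : x y / x <= y}].

Definition degree_one phi : Prop := exists f, good_lift phi f.

Definition upper_semicontinuous f : Prop :=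
  forall x a, f x < a -> \forall y \near x, f y < a.

Definition usc_map phi : Prop :=
  exists f, good_lift phi f /\ upper_semicontinuous f.

Definition lsc_map phi : Prop :=
  exists f, good_lift phi f /\ lower_semicontinuous (EFin \o f).

End degree_one.

(* Orientation-preserving homeomorphisms of the line are the increasing ones. *)
Record Htilde (R : realType) : Type := MkHtilde {
  Htilde_fun :> R -> R;
  Htilde_homeo : is_homeo Htilde_fun;
  Htilde_incr : {homo Htilde_fun : x y / x < y};
  Htilde_add1 : forall x, Htilde_fun (x + 1) = Htilde_fun x + 1
}.

Lemma Htilde_eqP {R : realType} (f g : Htilde R) : f =1 g -> f = g.
Proof.
case: f g => [f f1 f2 f3] [g g1 g2 g3] /= /funext fg; subst g.
by congr MkHtilde; exact: Prop_irrelevance.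
Qed.

Section Htilde_group.
Context {R : realType}.
Implicit Types f g : Htilde R.

Lemma Htilde_le f : {mono f : x y / x <= y}.
Proof. exact/le_mono/Htilde_incr. Qed.

Lemma Htilde_lt f : {mono f : x y / x < y}.
Proof. exact/leW_mono/Htilde_le. Qed.

Lemma Htilde_inj f : injective f.
Proof. exact/inc_inj/Htilde_le. Qed.

Lemma add1_addn (f : R -> R) (n : nat) x :
  (forall x, f (x + 1) = f x + 1) -> f (x + n%:R) = f x + n%:R.
Proof.
move=> f1; elim: n => [|n IHn]; first by rewrite !addr0.
by rewrite -natr1 addrA f1 IHn addrA.
Qed.

Lemma add1_addz (f : R -> R) (n : int) x :
  (forall x, f (x + 1) = f x + 1) -> f (x + n%:~R) = f x + n%:~R.
Proof.
move=> f1; case: n => n; first exact: add1_addn.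
rewrite NegzE mulrNz -[in RHS](subrK (n.+1%:R : R) x) (add1_addn _ _ f1).
by rewrite addrK.
Qed.

Definition Htilde_one : Htilde R :=
  @MkHtilde R id is_homeo_id (fun _ _ => id) (fun=> erefl).

Definition Htilde_mul f g : Htilde R.
Proof.
apply: (@MkHtilde R (f \o g)).
- exact: is_homeo_comp (Htilde_homeo f) (Htilde_homeo g).
- by move=> x y xy /=; rewrite !Htilde_lt.
- by move=> x /=; rewrite !Htilde_add1.
Defined.

Definition Htilde_inv f : Htilde R.
Proof.
apply: (@MkHtilde R (homeo_inv (Htilde_homeo f))).
- exact: is_homeo_inv.
- by move=> x y xy; rewrite -(Htilde_lt f) !homeo_invKV.
- by move=> x; apply: (@Htilde_inj f); rewrite Htilde_add1 !homeo_invKV.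
Defined.

Lemma Htilde_mulA : associative Htilde_mul.
Proof. by move=> f g h; exact: Htilde_eqP. Qed.
Lemma Htilde_mul1 : left_id Htilde_one Htilde_mul.
Proof. by move=> f; exact: Htilde_eqP. Qed.
Lemma Htilde_mulr1 : right_id Htilde_one Htilde_mul.
Proof. by move=> f; exact: Htilde_eqP. Qed.
Lemma Htilde_mulV : left_inverse Htilde_one Htilde_inv Htilde_mul.
Proof. by move=> f; apply: Htilde_eqP => x /=; exact: homeo_invK. Qed.
Lemma Htilde_mulrV : right_inverse Htilde_one Htilde_inv Htilde_mul.
Proof. by move=> f; apply: Htilde_eqP => x /=; exact: homeo_invKV. Qed.

End Htilde_group.

HB.instance Definition _ (R : realType) := gen_eqMixin (Htilde R).
HB.instance Definition _ (R : realType) := gen_choiceMixin (Htilde R).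
HB.instance Definition _ (R : realType) := isGroup.Build (Htilde R)
  Htilde_mulA Htilde_mul1 Htilde_mulr1 Htilde_mulV Htilde_mulrV.

Lemma HtildeM {R : realType} (f g : Htilde R) x : (f * g)%g x = f (g x).
Proof. by []. Qed.

(* Orientation-preserving is read on lifts: a homeomorphism of R/Z preserves the
   orientation iff it has a non-decreasing lift commuting with [x |-> x + 1].
   Such a lift is then in [Htilde], see [Homeo_lift]. *)
Record Homeo_circle (R : realType) : Type := MkHomeo {
  Homeo_fun :> circle R -> circle R;
  Homeo_homeo : is_homeo Homeo_fun;
  Homeo_orient : degree_one Homeo_fun
}.

Lemma Homeo_eqP {R : realType} (f g : Homeo_circle R) : f =1 g -> f = g.
Proof.
case: f g => [f f1 f2] [g g1 g2] /= /funext fg; subst g.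
by congr MkHomeo; exact: Prop_irrelevance.
Qed.

Lemma increasing_bij_continuous {R : realType} (f g : R -> R) :
  {mono f : x y / x <= y} -> cancel g f -> continuous f.
Proof.
move=> fle gK x; apply/cvgrPdist_lt => e e0.
have flt := leW_mono fle.
have xa : g (f x - e) < x by rewrite -flt gK ltrBlDr ltrDl.
have xb : x < g (f x + e) by rewrite -flt gK ltrDl.
near=> y.
rewrite ltr_distlC; apply/andP; split.
- rewrite -(gK (f x - e)) flt; near: y; exact: lt_nbhsr.
- rewrite -(gK (f x + e)) flt; near: y; exact: lt_nbhsl.
Unshelve. all: by end_near. Qed.

Section Homeo_group.
Context {R : realType}.
Implicit Types h k : Homeo_circle R.

Lemma Homeo_inj h : injective h.
Proof. exact: can_inj (homeo_invK (Homeo_homeo h)). Qed.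

Lemma Homeo_lift h : exists f : Htilde R,
  forall x, circle_pi (f x) = h (circle_pi x).
Proof.
have [f [fh f1 fle]] := Homeo_orient h.
have finj : injective f.
  move=> x y fxy; have /circle_piP[n xyn] : circle_pi x = circle_pi y.
    by apply: (@Homeo_inj h); rewrite -!fh fxy.
  move: fxy; rewrite xyn add1_addz// => /eqP.
  by rewrite -subr_eq0 addrC addKr => /eqP ->; rewrite addr0.
have fsurj y : exists x, f x = y.
  pose z := homeo_inv (Homeo_homeo h) (circle_pi y).
  have [x xz] := circle_pi_surj z.
  have /circle_piP[n yn] : circle_pi y = circle_pi (f x).
    by rewrite fh xz homeo_invKV.
  by exists (x + n%:~R); rewrite add1_addz.
pose g y := sval (cid (fsurj y)).
have gK : cancel g f by move=> y; rewrite /g; case: cid.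
have fK : cancel f g by move=> x; apply: finj; rewrite gK.
have flt : {homo f : x y / x < y} by exact: inj_homo_lt.
have fmono := le_mono flt.
have gmono : {mono g : x y / x <= y} by exact: can_mono gK fmono.
have hf : is_homeo f.
  split; first exact: increasing_bij_continuous fmono gK.
  exists g; split=> //; exact: increasing_bij_continuous gmono fK.
by exists (MkHtilde hf flt f1).
Qed.

Lemma Htilde_good_lift (f : Htilde R) (h : circle R -> circle R) :
  (forall x, circle_pi (f x) = h (circle_pi x)) -> good_lift h f.
Proof.
move=> fh; split=> //; first exact: Htilde_add1.
by move=> x y; rewrite Htilde_le.
Qed.

Lemma circle_funP (h k : circle R -> circle R) :
  (forall x, h (circle_pi x) = k (circle_pi x)) -> h =1 k.
Proof. by move=> hk z; have [x <-] := circle_pi_surj z. Qed.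

Definition Homeo_one : Homeo_circle R.
Proof.
apply: (@MkHomeo R id is_homeo_id).
by exists id; split=> // x y.
Defined.

Definition Homeo_mul h k : Homeo_circle R.
Proof.
apply: (@MkHomeo R (h \o k)).
  exact: is_homeo_comp (Homeo_homeo h) (Homeo_homeo k).
have [f fh] := Homeo_lift h; have [g gk] := Homeo_lift k.
by exists (f * g)%g; apply: Htilde_good_lift => x; rewrite HtildeM fh gk.
Defined.

Definition Homeo_inv h : Homeo_circle R.
Proof.
apply: (@MkHomeo R (homeo_inv (Homeo_homeo h))); first exact: is_homeo_inv.
have [f fh] := Homeo_lift h.
exists (f^-1)%g; apply: Htilde_good_lift => x.
by apply: (@Homeo_inj h); rewrite -fh homeo_invKV -HtildeM mulgV.
Defined.

Lemma Homeo_mulA : associative Homeo_mul.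
Proof. by move=> f g h; exact: Homeo_eqP. Qed.
Lemma Homeo_mul1 : left_id Homeo_one Homeo_mul.
Proof. by move=> f; exact: Homeo_eqP. Qed.
Lemma Homeo_mulr1 : right_id Homeo_one Homeo_mul.
Proof. by move=> f; exact: Homeo_eqP. Qed.
Lemma Homeo_mulV : left_inverse Homeo_one Homeo_inv Homeo_mul.
Proof. by move=> f; apply: Homeo_eqP => x /=; exact: homeo_invK. Qed.
Lemma Homeo_mulrV : right_inverse Homeo_one Homeo_inv Homeo_mul.
Proof. by move=> f; apply: Homeo_eqP => x /=; exact: homeo_invKV. Qed.

End Homeo_group.

HB.instance Definition _ (R : realType) := gen_eqMixin (Homeo_circle R).
HB.instance Definition _ (R : realType) := gen_choiceMixin (Homeo_circle R).
HB.instance Definition _ (R : realType) := isGroup.Build (Homeo_circle R)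
  Homeo_mulA Homeo_mul1 Homeo_mulr1 Homeo_mulV Homeo_mulrV.

Lemma HomeoM {R : realType} (h k : Homeo_circle R) z : (h * k)%g z = h (k z).
Proof. by []. Qed.

Section central_extension.
Context {R : realType}.
Implicit Types (f g : Htilde R) (h : Homeo_circle R).

Lemma translation_homeo (a : R) : is_homeo (fun x => x + a).
Proof.
split; first by move=> x; apply: cvgD; [exact: cvg_id|exact: cvg_cst].
exists (fun x => x - a); split; [|exact: addrK|exact: subrK].
by move=> x; apply: cvgB; [exact: cvg_id|exact: cvg_cst].
Qed.

Definition Htilde_incl (n : int) : Htilde R.
Proof.
apply: (@MkHtilde R (fun x => x + n%:~R) (translation_homeo _)).
- by move=> x y; rewrite ltrD2r.
- by move=> x; rewrite addrAC.
Defined.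

Lemma Htilde_inclE n x : Htilde_incl n x = x + n%:~R.
Proof. by []. Qed.

Definition circle_map f (z : circle R) : circle R := circle_pi (f (repr z)).

Lemma circle_mapE f x : circle_map f (circle_pi x) = circle_pi (f x).
Proof.
have /circle_piP[n xE] : circle_pi (repr (circle_pi x)) = circle_pi x.
  exact: reprK.
apply/circle_piP; exists n; rewrite xE; apply: add1_addz; exact: Htilde_add1.
Qed.

Lemma circle_map_continuous f : continuous (circle_map f).
Proof.
apply: circle_continuous.
rewrite (_ : _ \o _ = circle_pi \o f); last first.
  by apply/funext => x; exact: circle_mapE.
move=> x; apply: continuous_comp; last exact: circle_pi_continuous.
exact: (Htilde_homeo f).1.
Qed.

Definition Htilde_proj f : Homeo_circle R.
Proof.
apply: (@MkHomeo R (circle_map f)).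
  split; first exact: circle_map_continuous.
  exists (circle_map f^-1%g); split; first exact: circle_map_continuous.
  - by apply: circle_funP => x; rewrite !circle_mapE -HtildeM mulVg.
  - by apply: circle_funP => x; rewrite !circle_mapE -HtildeM mulgV.
by exists f; apply: Htilde_good_lift => x; rewrite circle_mapE.
Defined.

Lemma Htilde_projE f x : Htilde_proj f (circle_pi x) = circle_pi (f x).
Proof. exact: circle_mapE. Qed.

Lemma Htilde_projM : {morph Htilde_proj : f g / (f * g)%g}.
Proof.
move=> f g; apply/Homeo_eqP/circle_funP => x.
by rewrite HomeoM !Htilde_projE.
Qed.

Lemma Htilde_proj_surj h : exists f, Htilde_proj f = h.
Proof.
have [f fh] := Homeo_lift h; exists f.
by apply/Homeo_eqP/circle_funP => x; rewrite Htilde_projE fh.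
Qed.

Lemma Htilde_inclD m n :
  Htilde_incl (m + n) = (Htilde_incl m * Htilde_incl n)%g.
Proof.
by apply: Htilde_eqP => x; rewrite HtildeM !Htilde_inclE intrD addrAC addrA.
Qed.

Lemma Htilde_incl_inj : injective Htilde_incl.
Proof.
move=> m n /(congr1 (fun f : Htilde R => f 0)).
by rewrite !Htilde_inclE !add0r => /intr_inj.
Qed.

Lemma Htilde_incl_central n f : (f * Htilde_incl n = Htilde_incl n * f)%g.
Proof.
apply: Htilde_eqP => x; rewrite !HtildeM !Htilde_inclE.
by apply: add1_addz; exact: Htilde_add1.
Qed.

Lemma Htilde_proj_eq f g : Htilde_proj f = Htilde_proj g ->
  exists n, f = (g * Htilde_incl n)%g.
Proof.
move=> fg.
have fgn x : exists n : int, f x = g x + n%:~R.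
  by apply/circle_piP; rewrite -!Htilde_projE fg.
pose n x := sval (cid (fgn x)).
have nE x : f x = g x + (n x)%:~R by rewrite /n; case: cid.
have n_le x y : x <= y < x + 1 -> n x = n y.
  move=> /andP[xy yx1].
  have fxy : f x <= f y by rewrite Htilde_le.
  have gxy : g x <= g y by rewrite Htilde_le.
  have fyx : f y < f x + 1 by rewrite -Htilde_add1 Htilde_lt.
  have gyx : g y < g x + 1 by rewrite -Htilde_add1 Htilde_lt.
  move: fxy fyx; rewrite !nE => fxy fyx.
  have h1 : ((n x)%:~R : R) < (n y + 1)%:~R by rewrite intrD; lra.
  have h2 : ((n y)%:~R : R) < (n x + 1)%:~R by rewrite intrD; lra.
  by move: h1 h2; rewrite !ltr_int !ltzD1 => h1 h2; apply/eqP; rewrite eq_le h1.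
exists (n 0); apply: Htilde_eqP => x.
have xE : x = (x - (Num.floor x)%:~R) + (Num.floor x)%:~R by rewrite subrK.
rewrite HtildeM Htilde_inclE [in RHS]add1_addz; last exact: Htilde_add1.
rewrite [in LHS]xE [in RHS]xE !add1_addz; try exact: Htilde_add1.
rewrite nE (@n_le 0 (x - (Num.floor x)%:~R)); first by rewrite addrAC.
have /andP[h1 h2] := floor_itv x.
by rewrite subr_ge0 h1 add0r ltrBlDr addrC -intrD1.
Qed.

End central_extension.

Section bounded_cohomology.
Variable G : groupType.
Implicit Types (b : G -> int) (c : G -> G -> int).

Definition bounded1 b : Prop := exists M : int, forall g, `|b g| <= M.

Definition bounded2 c : Prop := exists M : int, forall g h, `|c g h| <= M.

Definition coboundary1 b : G -> G -> int :=
  fun g h => b h - b (g * h)%g + b g.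

Definition coboundary2 c : G -> G -> G -> int :=
  fun g h k => c h k - c (g * h)%g k + c g (h * k)%g - c g h.

(* [coboundary1] and [coboundary2] are the inhomogeneous differentials, for the
   trivial action on the coefficients. *)
Definition bounded_cocycle : {pred G -> G -> int} :=
  fun c => `[< bounded2 c /\ coboundary2 c = 0 >].

Lemma bounded_cocycleP c :
  reflect (bounded2 c /\ forall g h k, coboundary2 c g h k = 0)
          (c \in bounded_cocycle).
Proof.
apply: (iffP (asboolP _)) => -[bc dc]; split=> //; first by move=> *; rewrite dc.
by apply/funext => g; apply/funext => h; apply/funext => k; exact: dc.
Qed.

Fact bounded_cocycle_zmod : zmod_closed bounded_cocycle.
Proof.
split=> [|c c'].
  by apply/bounded_cocycleP; split; [exists 0|].
move=> /bounded_cocycleP[[M cM] dc] /bounded_cocycleP[[M' cM'] dc'].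
apply/bounded_cocycleP; split.
  exists (M + M') => g h.
  by apply: le_trans (ler_normB _ _) _; exact: lerD.
move=> g h k; move: (dc g h k) (dc' g h k).
by rewrite /coboundary2 !fctE /= => e e'; lra.
Qed.

HB.instance Definition _ :=
  GRing.isZmodClosed.Build _ bounded_cocycle bounded_cocycle_zmod.

Record Z2b : Type := MkZ2b {
  Z2b_val :> G -> G -> int;
  Z2bP : Z2b_val \in bounded_cocycle
}.

HB.instance Definition _ := [isSub for Z2b_val].
HB.instance Definition _ := [Choice of Z2b by <:].
HB.instance Definition _ := [SubChoice_isSubZmodule of Z2b by <:].

Definition bounded_coboundary : {pred Z2b} :=
  fun z => `[< exists b, bounded1 b /\ Z2b_val z = coboundary1 b >].

Lemma bounded_coboundaryP (z : Z2b) :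
  reflect (exists b, bounded1 b /\ forall g h, z g h = coboundary1 b g h)
          (z \in bounded_coboundary).
Proof.
apply: (iffP (asboolP _)) => -[b [bb cb]]; exists b; split=> //.
  by move=> g h; rewrite cb.
by apply/funext => g; apply/funext => h; exact: cb.
Qed.

Fact bounded_coboundary_zmod : zmod_closed bounded_coboundary.
Proof.
split=> [|z z'].
  by apply/bounded_coboundaryP; exists 0; split; [exists 0|].
move=> /bounded_coboundaryP[b [[M bM] cb]] /bounded_coboundaryP[b' [[M' bM'] cb']].
apply/bounded_coboundaryP; exists (b - b'); split.
  exists (M + M') => g.
  by apply: le_trans (ler_normB _ _) _; exact: lerD.
move=> g h; transitivity (z g h - z' g h) => //; rewrite cb cb' /coboundary1 !fctE; lra.
Qed.

HB.instance Definition _ :=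
  GRing.isZmodClosed.Build _ bounded_coboundary bounded_coboundary_zmod.

Definition B2b : zmodClosed Z2b :=
  GRing.ZmodClosed.clone Z2b bounded_coboundary _.

Definition H2b : zmodType := Quotient.quot B2b.

Definition H2b_class (z : Z2b) : H2b := \pi_(Quotient.quot B2b) z.

Lemma H2b_classP (z z' : Z2b) : H2b_class z = H2b_class z' <->
  exists b, bounded1 b /\ forall g h, z g h - z' g h = coboundary1 b g h.
Proof.
rewrite /H2b_class (rwP eqP) -Quotient.idealrBE -(rwP (bounded_coboundaryP _)).
by split=> -[b [bb e]]; exists b; split.
Qed.

End bounded_cohomology.

Section pullback.
Context {G H : groupType} (rho : {multiplicative G -> H}).

Fact Z2b_pullback_proof (c : Z2b H) :
  (fun g h => c (rho g) (rho h)) \in @bounded_cocycle G.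
Proof.
have /bounded_cocycleP[[M cM] dc] := Z2bP c.
apply/bounded_cocycleP; split; first by exists M.
by move=> g h k; rewrite -(dc (rho g) (rho h) (rho k)) /coboundary2 !gmulfM.
Qed.

Definition Z2b_pullback (c : Z2b H) : Z2b G := MkZ2b (Z2b_pullback_proof c).

(* The value does not depend on the representative, see [H2b_pullbackE]. *)
Definition H2b_pullback (a : H2b H) : H2b G :=
  H2b_class (Z2b_pullback (repr (a : Quotient.quot (B2b H)))).

Lemma H2b_pullbackE (c : Z2b H) :
  H2b_pullback (H2b_class c) = H2b_class (Z2b_pullback c).
Proof.
apply/H2b_classP; set c' := repr _.
have /H2b_classP[b [[M bM] cb]] : H2b_class c' = H2b_class c by exact: reprK.
exists (b \o rho); split; first by exists M => g; exact: bM.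
by move=> g h /=; rewrite cb /coboundary1 /= gmulfM.
Qed.

End pullback.

Record bounded_section (R : realType) : Type := MkBoundedSection {
  section_fun :> Homeo_circle R -> Htilde R;
  section_proj : forall h, Htilde_proj (section_fun h) = h;
  section_bounded : exists M : R, forall h, `|section_fun h 0| <= M
}.

Section euler_cocycle.
Context {R : realType} (sigma : bounded_section R).

Lemma euler_cocycle_exists h k : exists n : int,
  (sigma h * sigma k = sigma (h * k) * Htilde_incl n)%g.
Proof. by apply: Htilde_proj_eq; rewrite Htilde_projM !section_proj. Qed.

Definition euler_cocycle h k : int := sval (cid (euler_cocycle_exists h k)).

Lemma euler_cocycleE h k :
  (sigma h * sigma k = sigma (h * k) * Htilde_incl (euler_cocycle h k))%g.
Proof. by rewrite /euler_cocycle; case: cid. Qed.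

Lemma euler_cocycle_eval h k x :
  sigma h (sigma k x) = sigma (h * k)%g x + (euler_cocycle h k)%:~R.
Proof.
rewrite -HtildeM euler_cocycleE HtildeM Htilde_inclE.
by apply: add1_addz; exact: Htilde_add1.
Qed.

Lemma Htilde_bound (f : Htilde R) y : `|f y| <= `|f 0| + `|y| + 1.
Proof.
have /andP[ly yl] := floor_itv y.
have l0 : f 0 + (Num.floor y)%:~R <= f y.
  rewrite -[X in X <= _]add1_addz ?add0r ?Htilde_le//; exact: Htilde_add1.
have u0 : f y <= f 0 + (Num.floor y + 1)%:~R.
  rewrite -[X in _ <= X]add1_addz ?add0r ?Htilde_le ?ltW//; exact: Htilde_add1.
move: yl u0; rewrite intrD => yl u0.
have := ler_norm (f 0); have := ler_norm (- f 0).
have := ler_norm y; have := ler_norm (- y); rewrite !normrN => h1 h2 h3 h4.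
by rewrite ler_norml; apply/andP; split; lra.
Qed.

Fact euler_cocycle_bounded : euler_cocycle \in @bounded_cocycle (Homeo_circle R).
Proof.
apply/bounded_cocycleP; split.
  have [M sM] := section_bounded sigma.
  exists (Num.ceil (M + M + M + 1)) => h k; rewrite -(ler_int R).
  apply: le_trans (ceil_ge _); rewrite intr_norm.
  have -> : (euler_cocycle h k)%:~R = sigma h (sigma k 0) - sigma (h * k)%g 0.
    by rewrite euler_cocycle_eval addrC addKr.
  apply: le_trans (ler_normB _ _) _.
  have := Htilde_bound (sigma h) (sigma k 0).
  by have := sM h; have := sM k; have := sM (h * k)%g; lra.
move=> h k l; apply: (@intr_inj R); rewrite /coboundary2.
have e1 := euler_cocycle_eval h k (sigma l 0).
have e2 := euler_cocycle_eval (h * k)%g l 0.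
have e3 := euler_cocycle_eval k l 0.
have e4 := euler_cocycle_eval h (k * l)%g 0.
have e5 : sigma h (sigma (k * l)%g 0 + (euler_cocycle k l)%:~R) =
  sigma h (sigma (k * l)%g 0) + (euler_cocycle k l)%:~R.
  by apply: add1_addz; exact: Htilde_add1.
move: e1; rewrite e3 e5 e2 e4 mulgA !(intrD, intrB) => e1.
by rewrite -[0 in RHS]/(0%:~R); lra.
Qed.

Definition euler_class : H2b (Homeo_circle R) :=
  H2b_class (MkZ2b euler_cocycle_bounded).

End euler_cocycle.

Lemma euler_class_indep {R : realType} (sigma tau : bounded_section R) :
  euler_class tau = euler_class sigma.
Proof.
have st h : exists n : int, tau h = (sigma h * Htilde_incl n)%g.
  by apply: Htilde_proj_eq; rewrite !section_proj.
pose b h := sval (cid (st h)).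
have bE h x : tau h x = sigma h x + (b h)%:~R.
  rewrite /b; case: cid => n /= ->; rewrite HtildeM Htilde_inclE.
  by apply: add1_addz; exact: Htilde_add1.
apply/H2b_classP; exists b; split.
  have [M sM] := section_bounded sigma; have [N tN] := section_bounded tau.
  exists (Num.ceil (N + M)) => h; rewrite -(ler_int R) intr_norm.
  apply: le_trans (ceil_ge _).
  have -> : (b h)%:~R = tau h 0 - sigma h 0 by rewrite bE addrC addKr.
  by apply: le_trans (ler_normB _ _) _; exact: lerD.
move=> h k /=; apply: (@intr_inj R); rewrite /coboundary1 !(intrD, intrB).
have e1 := euler_cocycle_eval tau h k 0.
have e2 := euler_cocycle_eval sigma h k 0.
have e3 : sigma h (sigma k 0 + (b k)%:~R) = sigma h (sigma k 0) + (b k)%:~R.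
  by apply: add1_addz; exact: Htilde_add1.
by move: e1; rewrite !bE e3 e2; lra.
Qed.

Section standard_section.
Context {R : realType}.

Lemma standard_lift (h : Homeo_circle R) :
  exists f : Htilde R, Htilde_proj f = h /\ 0 <= f 0 < 1.
Proof.
have [f fh] := Htilde_proj_surj h.
exists (f * Htilde_incl (- Num.floor (f 0)))%g.
have fE x : (f * Htilde_incl (- Num.floor (f 0)))%g x =
    f x - (Num.floor (f 0))%:~R.
  rewrite HtildeM Htilde_inclE -intrN; apply: add1_addz; exact: Htilde_add1.
split.
  apply/Homeo_eqP/circle_funP => x; rewrite -fh !Htilde_projE fE.
  by apply/circle_piP; exists (- Num.floor (f 0)); rewrite intrN.
have /andP[h1 h2] := floor_itv (f 0).
by rewrite fE subr_ge0 h1 ltrBlDr addrC -intrD1.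
Qed.

Definition standard_section : bounded_section R.
Proof.
apply: (@MkBoundedSection R (fun h => sval (cid (standard_lift h)))).
- by move=> h; case: cid => f [].
- exists 1 => h; case: cid => f [_ /andP[f0 f1]] /=.
  by rewrite ger0_norm// ltW.
Defined.

End standard_section.

(* Any other bounded section gives the same class, see [euler_class_indep]. *)
Definition eu_b (R : realType) : H2b (Homeo_circle R) :=
  euler_class (@standard_section R).

Section actions.
Context {R : realType} {Gamma : groupType}.
Implicit Types rho : {multiplicative Gamma -> Homeo_circle R}.

Definition bounded_euler_class rho : H2b Gamma := H2b_pullback rho (eu_b R).

Definition global_fixed_point rho (x : circle R) : Prop :=
  forall g, rho g x = x.

Definition left_semiconjugacy rho1 rho2 (phi : circle R -> circle R) : Prop :=
  degree_one phi /\ forall g x, rho1 g (phi x) = phi (rho2 g x).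

(* [C] restricts the regularity of the semi-conjugacies: [setT], [usc_map] or
   [lsc_map]. *)
Definition left_semiconjugate (C : set (circle R -> circle R)) rho1 rho2 : Prop :=
  exists phi, C phi /\ left_semiconjugacy rho1 rho2 phi.

Definition right_semiconjugate (C : set (circle R -> circle R)) rho1 rho2 : Prop :=
  left_semiconjugate C rho2 rho1.

End actions.

(* Main.v *)
(* A semi-conjugacy admitting equivariant lifts (condition iv) stays at bounded
   distance from the identity, so the two families of lifts give the same
   integer cocycle and differ from bounded lifts by functions whose difference
   is bounded: the bounded Euler classes agree.  Conversely, equal classes give
   bounded families of lifts [a g], [b g] with the same cocycle, and then
   [sup_g a g^-1 (b g x)] (resp. [inf_g]) is an equivariant lower (resp. upper)
   semi-continuous good lift; this makes the relation symmetric and independent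
   of the regularity required.  Good lifts of a non-constant map are unique up to
   an integer, so every non-constant semi-conjugacy satisfies (iv), while
   a constant one forces a fixed point of [rho1] and (iv) then amounts to a fixed
   point of [rho2].  Finally, the points where a lift of [phi] is strictly larger
   than at all points on the left (or strictly smaller than at all points on the
   right) form the invariant set on which [phi] is injective. *)
Require Import Defs.
From mathcomp Require Import all_boot all_order all_algebra.
From mathcomp Require Import all_classical all_reals all_analysis.
From mathcomp Require Import lra zify.

Set Implicit Arguments.
Unset Strict Implicit.
Unset Printing Implicit Defensive.

Import Order.TTheory GRing.Theory Num.Theory.
Import numFieldNormedType.Exports.

Local Open Scope classical_set_scope.
Local Open Scope ring_scope.

(** * Good lifts and their uniqueness *)

Section good_lifts.
Context {R : realType}.
Implicit Types (phi : circle R -> circle R) (f : R -> R).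

(** Monotonicity squeezes [f x] between the values of [f] at the two integers around [x]. *)
Lemma degree_one_near_translation f :
  (forall x, f (x + 1) = f x + 1) -> {homo f : x y / x <= y} ->
  forall x, `|f x - (f 0 + x)| <= 1.
Proof.
move=> f1 fle x; have /andP[lx xl] := floor_itv x.
have l0 : f 0 + (Num.floor x)%:~R <= f x.
  by rewrite -[leLHS](add1_addz _ _ f1) add0r fle.
have u0 : f x <= f 0 + (Num.floor x + 1)%:~R.
  by rewrite -[leRHS](add1_addz _ _ f1) add0r fle// ltW.
move: xl u0; rewrite intrD => xl u0.
by rewrite ler_norml; apply/andP; split; lra.
Qed.

Lemma Htilde_near_translation (f : Htilde R) x : `|f x - (f 0 + x)| <= 1.
Proof.
apply: (@degree_one_near_translation f); first exact: Htilde_add1.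
by move=> y z; rewrite Htilde_le.
Qed.

Lemma good_lift_exists f :
  (forall x, f (x + 1) = f x + 1) -> {homo f : x y / x <= y} ->
  exists phi, good_lift phi f.
Proof.
move=> f1 fle; exists (fun z => circle_pi (f (repr z))); split=> // x.
have /circle_piP[n xE] : circle_pi (repr (circle_pi x)) = circle_pi x.
  exact: reprK.
apply/circle_piP; exists (- n); rewrite xE (add1_addz n _ f1) intrN.
by rewrite addrK.
Qed.

(** After reduction to [x <= y <= x + 1], both lifts grow by an amount in [[0, 1]] from [x] to [y].
    Hence [m - n] is [1] or [-1], and [f y] is [f x + 1] or [f x] respectively. *)
Lemma good_lift_jump phi f f' x y (n m : int) :
  good_lift phi f -> good_lift phi f' ->
  f x = f' x + n%:~R -> f y = f' y + m%:~R -> n != m ->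
  phi (circle_pi x) = phi (circle_pi y).
Proof.
move=> [fp f1 fle] [_ f1' fle'].
wlog xy : x y n m / x <= y.
  move=> W fx fy nm; have [xy|/ltW yx] := leP x y; first exact: W fx fy nm.
  by apply/esym; apply: W fy fx _ => //; rewrite eq_sym.
(* Moving [y] by an integer changes neither [circle_pi y] nor [m]. *)
wlog yx1 : y m xy / y <= x + 1.
  move=> W fx fy nm; pose k := Num.floor (y - x).
  have := floor_itv (y - x); rewrite -/k intrD => /andP[k1 k2].
  have -> : circle_pi y = circle_pi (y + (- k)%:~R).
    by apply/circle_piP; exists k; rewrite intrN subrK.
  apply: (W _ m) => //; rewrite ?intrN; [lra|lra|].
  by rewrite -intrN !add1_addz// fy addrAC.
move=> fx fy nm; rewrite -!fp; apply/circle_piP.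
have {fle xy yx1} [h1 h2 h3 h4] :
    [/\ f x <= f y, f y <= f x + 1, f' x <= f' y & f' y <= f' x + 1].
  by rewrite -f1 -f1'; split; auto.
have : m - n <= 1 by rewrite -(ler_int R) intrD intrN; lra.
have : -1 <= m - n by rewrite -(ler_int R) intrD !intrN; lra.
move=> ge le; have [gt|lt] : n + 1 <= m \/ m + 1 <= n.
- by move: nm; lia.
- move: gt; rewrite -(ler_int R) intrD => gt.
  by exists (-1); rewrite intrN; lra.
- move: lt; rewrite -(ler_int R) intrD => lt.
  by exists 0; lra.
Qed.

Lemma good_lift_unique phi f f' :
  good_lift phi f -> good_lift phi f' -> (exists x y, phi x <> phi y) ->
  exists n : int, forall x, f x = f' x + n%:~R.
Proof.
move=> F F' [z1 [z2 z12]].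
have fn x : exists n : int, f x = f' x + n%:~R.
  by apply/circle_piP; have [-> _ _] := F; have [-> _ _] := F'.
have [n0 fn0] := fn 0; exists n0 => x; have [n fx] := fn x.
have [<-//|nn0] := eqVneq n n0.
(* Since the integers at [x] and [0] differ, [phi] takes the same value over both; the integer at
   any [y] differs from one of the two, so [phi] is constant. *)
case: z12; suff const z : phi z = phi (circle_pi 0) by rewrite !const.
have [y <-] := circle_pi_surj z; have [m fy] := fn y.
have [mn|mn] := eqVneq m n0; last exact: good_lift_jump F F' fy fn0 mn.
rewrite -(good_lift_jump F F' fx fn0 nn0).
by apply: good_lift_jump F F' fy fx _; rewrite mn eq_sym.
Qed.

End good_lifts.

(** * Equivariant maps from bounded families of lifts *)

Section bounded_lifts.
Context {R : realType} {Gamma : groupType}.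
Implicit Types (a b : Gamma -> Htilde R) (c : Gamma -> Gamma -> int).

Definition lift_cocycle a c : Prop :=
  forall g h x, a g (a h x) = a (g * h)%g x + (c g h)%:~R.

(* [f x] is the supremum over [g] of [a g^-1 (b g x)]. *)
Lemma equivariant_lsc_exists a b c (M : R) :
  lift_cocycle a c -> lift_cocycle b c ->
  (forall g, `|a g 0| <= M) -> (forall g, `|b g 0| <= M) ->
  exists f : R -> R, [/\ forall x, f (x + 1) = f x + 1,
    {homo f : x y / x <= y}, lower_semicontinuous (EFin \o f) &
    forall g x, a g (f x) = f (b g x)].
Proof.
move=> ac bc aM bM; pose u x g := ((a g)^-1)%g (b g x).
have le_u x g t : (u x g <= t) = (b g x <= a g t).
  by rewrite -(Htilde_le (a g)) /u -HtildeM mulgV.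
pose f x := sup (range (u x)).
have uf x g : u x g <= f x.
  apply: ub_le_sup; last by exists g.
  (* [b k x <= x + M + 1 <= a k (x + M + M + 2)], each map being within [1] of a translation by at
     most [M]. *)
  exists (x + M + M + 2) => _ [k _ <-]; rewrite le_u.
  have := Htilde_near_translation (a k) (x + M + M + 2).
  have := Htilde_near_translation (b k) x.
  by have := aM k; have := bM k; rewrite !ler_norml; lra.
have fu x t : (forall g, u x g <= t) -> f x <= t.
  move=> xt; apply: ge_sup; first by exists (u x 1%g); exists 1%g.
  by move=> _ [g _ <-]; exact: xt.
have equi g x : a g (f x) = f (b g x).
  (* The term of index [h] on one side is matched with the term of index [h / g], then [h * g], on
     the other; the cocycle [c] cancels because [a] and [b] share it. *)
  apply/le_anti/andP; split.
    rewrite -(Htilde_le ((a g)^-1)%g) -HtildeM mulVg; apply: fu => h.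
    set y := f _; have := uf (b g x) (h / g)%g; rewrite !le_u -/y.
    have := bc (h / g)%g g x; have := ac (h / g)%g g (((a g)^-1)%g y).
    by rewrite mulgVK -(HtildeM (a g)) mulgV => -> ->; rewrite lerD2r.
  apply: fu => h; rewrite le_u ac bc lerD2r -le_u; exact: uf.
have f_le : {homo f : x y / x <= y}.
  move=> x y xy; apply: fu => g; rewrite le_u.
  apply: (@le_trans _ _ (b g y)); first by rewrite Htilde_le.
  by rewrite -le_u; exact: uf.
exists f; split=> // [x|x t].
  apply/le_anti/andP; split.
    by apply: fu => g; rewrite le_u !Htilde_add1 lerD2r -le_u; exact: uf.
  rewrite -lerBrDr; apply: fu => g; rewrite le_u.
  by rewrite -(lerD2r 1) -!Htilde_add1 subrK -le_u; exact: uf.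
(* A single term of the supremum above [t] at [x] stays above [t] nearby, by continuity of [b g]. *)
rewrite lte_fin => tx; have [g] : exists g, t < u x g.
  apply: contrapT => /forallNP no; move: tx; rewrite ltNge => /negP; apply.
  by apply: fu => g; rewrite leNgt; apply/negP; exact: no.
rewrite ltNge le_u -ltNge => tg; exists [set y | a g t < b g y].
  exact: cvgr_gt ((Htilde_homeo (b g)).1 x) _ tg.
move=> y /= ty; rewrite lte_fin; apply: lt_le_trans (uf y g).
by rewrite ltNge le_u -ltNge.
Qed.

End bounded_lifts.

(** * Reflection of the line, exchanging lower and upper semi-continuity *)

Section reflection.
Context {R : realType}.

Lemma is_homeo_opp : is_homeo (fun x : R => - x).
Proof.
split; first by move=> x; exact: cvgN.
by exists -%R; split; [move=> x; exact: cvgN|exact: opprK|exact: opprK].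
Qed.

Definition Htilde_reflect (f : Htilde R) : Htilde R.
Proof.
apply: (@MkHtilde R (-%R \o (f \o -%R))).
- exact: is_homeo_comp is_homeo_opp (is_homeo_comp (Htilde_homeo f) is_homeo_opp).
- by move=> x y xy /=; rewrite ltrN2 Htilde_lt ltrN2.
- move=> x /=; have := Htilde_add1 f (- (x + 1)).
  by rewrite opprD subrK => ->; rewrite opprD addrNK.
Defined.

End reflection.

(** Conjugation by [x |-> - x] negates the cocycle and keeps the bound at [0], so the lower
    semi-continuous solution for the reflected lifts can be reflected back. *)
Lemma equivariant_usc_exists {R : realType} {Gamma : groupType}
    (a b : Gamma -> Htilde R) (c : Gamma -> Gamma -> int) (M : R) :
  lift_cocycle a c -> lift_cocycle b c ->
  (forall g, `|a g 0| <= M) -> (forall g, `|b g 0| <= M) ->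
  exists f : R -> R, [/\ forall x, f (x + 1) = f x + 1,
    {homo f : x y / x <= y}, upper_semicontinuous f &
    forall g x, a g (f x) = f (b g x)].
Proof.
have reflect_cocycle (d : Gamma -> Htilde R) : lift_cocycle d c ->
    lift_cocycle (Htilde_reflect \o d) (fun g h => - c g h).
  by move=> dc g h x; rewrite /= opprK dc opprD intrN.
move=> ac bc aM bM.
have reflect_bounded (d : Gamma -> Htilde R) : (forall g, `|d g 0| <= M) ->
    forall g, `|(Htilde_reflect \o d) g 0| <= M.
  by move=> dM g; rewrite /= oppr0 normrN.
have [f [f1 fle flsc fE]] := equivariant_lsc_exists (reflect_cocycle _ ac)
  (reflect_cocycle _ bc) (reflect_bounded _ aM) (reflect_bounded _ bM).
exists (fun x => - f (- x)); split.
- move=> x; have := f1 (- (x + 1)); rewrite opprD subrK => ->.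
  by rewrite opprD addrNK.
- by move=> x y xy; rewrite lerN2 fle// lerN2.
- move=> x t; rewrite ltrNl -lte_fin => /flsc[V xV Vt].
  have : \forall y \near x, V (- y) by exact: (@cvgN _ _ _ (nbhs x) _ id x).
  by apply: filterS => y /Vt; rewrite lte_fin ltrNl.
- move=> g x; have := fE g (- x); rewrite /= opprK => <-.
  by rewrite opprK.
Qed.

(** * Equivariant lifts and the bounded Euler class *)

Section semiconjugacy.
Context {R : realType} {Gamma : groupType}.
Implicit Types (rho : {multiplicative Gamma -> Homeo_circle R}).
Implicit Types (phi : circle R -> circle R) (C : set (circle R -> circle R)).

Lemma action1 rho : rho 1%g = 1%g.
Proof. by apply: (mulgI (rho 1%g)); rewrite -gmulfM !mulg1. Qed.

(** The existential part of (iv) for a fixed [phi]; every implication of the cycle after the first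
    goes through it. *)
Definition lift_equivariant rho1 rho2 phi : Prop :=
  exists (lrho1 lrho2 : Gamma -> Htilde R) (lphi : R -> R),
    [/\ forall g, Htilde_proj (lrho1 g) = rho1 g,
        forall g, Htilde_proj (lrho2 g) = rho2 g,
        good_lift phi lphi &
        forall g x, lrho1 g (lphi x) = lphi (lrho2 g x)].

Lemma lift_equivariant_semiconjugacy rho1 rho2 phi :
  lift_equivariant rho1 rho2 phi -> left_semiconjugacy rho1 rho2 phi.
Proof.
move=> [a [b [f [aP bP fphi ab]]]]; split; first by exists f.
move=> g z; have [x <-] := circle_pi_surj z; have [fP _ _] := fphi.
by rewrite -fP -aP -bP !Htilde_projE ab fP.
Qed.

Lemma bounded_euler_class_eqP rho1 rho2 :
  let c := euler_cocycle (@standard_section R) in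
  bounded_euler_class rho1 = bounded_euler_class rho2 <->
  exists b, bounded1 b /\ forall g h,
    c (rho1 g) (rho1 h) - c (rho2 g) (rho2 h) = coboundary1 b g h.
Proof.
by rewrite /= /bounded_euler_class /eu_b /euler_class !H2b_pullbackE; exact: H2b_classP.
Qed.

Lemma euler_class_lift_equivariant C rho1 rho2 :
  C = setT \/ C = usc_map \/ C = lsc_map ->
  bounded_euler_class rho1 = bounded_euler_class rho2 ->
  exists phi, C phi /\ lift_equivariant rho1 rho2 phi.
Proof.
move=> hC /bounded_euler_class_eqP[beta [[N betaN] cE]].
pose s := @standard_section R; have [M sM] := section_bounded s.
(* Adding the bounded primitive [beta] to the lifts of [rho2] turns their cocycle into that of the
   lifts of [rho1]. *)
pose a g := s (rho1 g); pose b g := (s (rho2 g) * Htilde_incl (beta g))%g.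
have bE g x : b g x = s (rho2 g) x + (beta g)%:~R.
  by rewrite /b HtildeM Htilde_inclE add1_addz//; exact: Htilde_add1.
have aP g : Htilde_proj (a g) = rho1 g by exact: section_proj.
have bP g : Htilde_proj (b g) = rho2 g.
  rewrite -(section_proj s (rho2 g)); apply/Homeo_eqP/circle_funP => x.
  by rewrite !Htilde_projE bE; apply/circle_piP; exists (beta g).
pose c g h := euler_cocycle s (rho1 g) (rho1 h).
have ac : lift_cocycle a c.
  by move=> g h x; rewrite /a euler_cocycle_eval -gmulfM.
have bc : lift_cocycle b c.
  move=> g h x; rewrite !bE add1_addz; last exact: Htilde_add1.
  rewrite euler_cocycle_eval -gmulfM /c -[euler_cocycle s (rho1 g) _](subrK
    (euler_cocycle s (rho2 g) (rho2 h))) cE /coboundary1 !(intrD, intrN).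
  lra.
have N0 : 0 <= N := le_trans (normr_ge0 _) (betaN 1%g).
have aMN g : `|a g 0| <= M + N%:~R.
  by rewrite (le_trans (sM _))// lerDl ler0z.
have bMN g : `|b g 0| <= M + N%:~R.
  rewrite bE (le_trans (ler_normD _ _))// lerD ?sM//.
  by rewrite -intr_norm ler_int.
have usc : exists phi, usc_map phi /\ lift_equivariant rho1 rho2 phi.
  have [f [f1 fle fusc fE]] := equivariant_usc_exists ac bc aMN bMN.
  have [phi fphi] := good_lift_exists f1 fle.
  by exists phi; split; [exists f|exists a, b, f].
have lsc : exists phi, lsc_map phi /\ lift_equivariant rho1 rho2 phi.
  have [f [f1 fle flsc fE]] := equivariant_lsc_exists ac bc aMN bMN.
  have [phi fphi] := good_lift_exists f1 fle.
  by exists phi; split; [exists f|exists a, b, f].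
by case: hC => [|[|]] -> //; have [phi [_ ?]] := usc; exists phi.
Qed.

(** The offsets [m1] and [m2] of the lifts from the section may each be unbounded; equivariance
    bounds their difference, which is the required primitive. *)
Lemma lift_equivariant_euler_class rho1 rho2 phi :
  lift_equivariant rho1 rho2 phi ->
  bounded_euler_class rho1 = bounded_euler_class rho2.
Proof.
move=> [a [b [f [aP bP [_ f1 fle] ab]]]]; apply/bounded_euler_class_eqP.
pose s := @standard_section R; have [M sM] := section_bounded s.
have lift_shift rho (d : Gamma -> Htilde R) :
    (forall g, Htilde_proj (d g) = rho g) ->
    exists m : Gamma -> int, forall g x, d g x = s (rho g) x + (m g)%:~R.
  move=> dP; have dm g : exists m, d g = (s (rho g) * Htilde_incl m)%g.
    by apply: Htilde_proj_eq; rewrite section_proj.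
  exists (fun g => sval (cid (dm g))) => g x; case: cid => m /= ->.
  by rewrite HtildeM Htilde_inclE add1_addz//; exact: Htilde_add1.
have [m1 aE] := lift_shift _ _ aP; have [m2 bE] := lift_shift _ _ bP.
exists (fun g => m2 g - m1 g); split.
  (* Comparing [a g (f 0)] and [f (b g 0)] with translates of [f 0] costs [1] each; the section
     costs [M] for each action. *)
  exists (Num.ceil (M + M + 2)) => g; rewrite -(ler_int R).
  apply: le_trans (ceil_ge _); rewrite intr_norm intrB.
  have := Htilde_near_translation (a g) (f 0).
  have := degree_one_near_translation f1 fle (b g 0).
  have := sM (rho1 g); have := sM (rho2 g).
  by rewrite ab aE bE !ler_norml; lra.
move=> g h; apply: (@intr_inj R); rewrite /coboundary1 !(intrB, intrD).
have fD x (n : int) : f (x + n%:~R) = f x + n%:~R by exact: add1_addz.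
have sD rho k x (n : int) : s (rho k) (x + n%:~R) = s (rho k) x + n%:~R.
  exact: add1_addz (@Htilde_add1 _ _).
have sM' rho x : s (rho g) (s (rho h) x) =
    s (rho (g * h)%g) x + (euler_cocycle s (rho g) (rho h))%:~R.
  by rewrite euler_cocycle_eval -gmulfM.
(* Equivariance computes both [a g (a h (f 0))] and [a (g * h) (f 0)]; comparing them leaves an
   identity between integers. *)
have := ab g (b h 0); rewrite -[f (b h 0)]ab aE [a h _]aE sD sM'.
have := ab (g * h)%g 0; rewrite aE.
rewrite !bE sD sM' !fD; lra.
Qed.

(** * Equivariant lifts of a given semi-conjugacy *)

Lemma lift_equivariant_of_nonconstant rho1 rho2 phi :
  left_semiconjugacy rho1 rho2 phi -> (exists x y, phi x <> phi y) ->
  lift_equivariant rho1 rho2 phi.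
Proof.
move=> [[f fphi] phiE] [x0 [y0 xy0]]; pose s := @standard_section R.
have [fP f1 fle] := fphi.
(* Both sides are good lifts of [rho1 g \o phi], which is not constant as [rho1 g] is injective. The
   integer is then absorbed into the lift of [rho2 g]. *)
have shift g : exists n : int,
    forall x, s (rho1 g) (f x) = f (s (rho2 g) x) + n%:~R.
  apply: (@good_lift_unique _ (rho1 g \o phi)).
  - split=> [x|x|x y xy].
    + by rewrite -Htilde_projE section_proj fP.
    + by rewrite f1 Htilde_add1.
    + by rewrite Htilde_le fle.
  - split=> [x|x|x y xy].
    + by rewrite fP /= phiE -[in RHS](section_proj s (rho2 g)) Htilde_projE.
    + by rewrite Htilde_add1 f1.
    + by rewrite fle// Htilde_le.
  - by exists x0, y0 => /= /(@Homeo_inj _ _).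
pose n g := sval (cid (shift g)).
have nE g : forall x, s (rho1 g) (f x) = f (s (rho2 g) x) + (n g)%:~R.
  exact: svalP (cid (shift g)).
exists (s \o rho1), (fun g => s (rho2 g) * Htilde_incl (n g))%g, f.
split=> // [g|g|g x]; first exact: section_proj.
  rewrite -[RHS](section_proj s); apply/Homeo_eqP/circle_funP => x.
  rewrite !Htilde_projE HtildeM Htilde_inclE add1_addz; last exact: Htilde_add1.
  by apply/circle_piP; exists (n g).
by rewrite /= nE !add1_addz//; exact: Htilde_add1.
Qed.

Lemma lift_fixing rho x : global_fixed_point rho (circle_pi x) ->
  exists d : Gamma -> Htilde R,
    (forall g, Htilde_proj (d g) = rho g) /\ forall g, d g x = x.
Proof.
move=> fix_x; suff fix_lift g : exists d : Htilde R, Htilde_proj d = rho g /\ d x = x.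
  by exists (fun g => sval (cid (fix_lift g))); split=> g; case: cid => d [].
have [d dP] := Htilde_proj_surj (rho g).
have /circle_piP[n dx] : circle_pi (d x) = circle_pi x.
  by rewrite -Htilde_projE dP fix_x.
have dE y : (d * Htilde_incl (- n))%g y = d y - n%:~R.
  by rewrite HtildeM Htilde_inclE add1_addz ?intrN//; exact: Htilde_add1.
exists (d * Htilde_incl (- n))%g; split; last by rewrite dE dx addrK.
rewrite -dP; apply/Homeo_eqP/circle_funP => y; rewrite !Htilde_projE dE.
by apply/circle_piP; exists (- n); rewrite intrN.
Qed.

(** The good lift is a staircase jumping at the points [x + n] over [p]: lifts of [rho2] fixing [x]
    preserve each step, and lifts of [rho1] fixing [y] fix each height. *)
Lemma lift_equivariant_of_constant rho1 rho2 (p q : circle R) :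
  global_fixed_point rho1 q -> global_fixed_point rho2 p ->
  lift_equivariant rho1 rho2 (fun=> q).
Proof.
have [y <-] := circle_pi_surj q; have [x <-] := circle_pi_surj p.
move=> /lift_fixing[a [aP ay]] /lift_fixing[b [bP bx]].
exists a, b, (fun t => y + (Num.floor (t - x))%:~R); split=> //.
  split=> [t|t|t u tu].
  - by apply/circle_piP; eexists.
  - by rewrite [t + 1 - x]addrAC floorDrz ?rpred1// floor1 intrD addrA.
  - by rewrite lerD2l ler_int le_floor// lerD2r.
move=> g t; rewrite add1_addz ?ay; last exact: Htilde_add1.
congr (_ + _%:~R); apply/esym/floor_def.
have := floor_itv (t - x); rewrite !lerBrDl !ltrBlDl.
have bD (n : int) : b g (x + n%:~R) = x + n%:~R.
  by rewrite add1_addz ?bx//; exact: Htilde_add1.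
by rewrite -(Htilde_le (b g)) -(Htilde_lt (b g)) !bD.
Qed.

(* If the supremum [s] of a fibre of [f] is not attained, then [s] is the
   minimum of its own fibre. *)
Lemma fibre_extremum (f : R -> R) : {homo f : x y / x <= y} ->
  (exists z, f 0 < f z) ->
  (exists x, forall z, x < z -> f x < f z) \/
  (exists x, forall z, z < x -> f z < f x).
Proof.
move=> fle [t ft]; pose s := sup [set x | f x <= f 0].
have ub : has_ubound [set x | f x <= f 0].
  exists t => x /= fx; rewrite leNgt; apply/negP => /ltW/fle tx; lra.
have s_gt z : s < z -> f 0 < f z.
  move=> sz; rewrite ltNge; apply/negP => fz.
  by have := ub_le_sup ub fz; rewrite leNgt sz.
have s_lt z : z < s -> f z <= f 0.
  move=> zs; have [|x fx zx] := @sup_gt _ [set x | f x <= f 0] z _ zs.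
    by exists 0 => /=.
  by apply: le_trans fx; apply/fle/ltW.
have [fs|fs] := leP (f s) (f 0); [left|right]; exists s => z.
  by move=> /s_gt; exact: le_lt_trans.
by move=> /s_lt zs; exact: le_lt_trans fs.
Qed.

(** Membership in [L] is a strict comparison of values of [f], which [b g] preserves since [a g] is
    strictly increasing. Two points of [L] with equal values cannot be ordered, hence coincide. *)
Lemma lift_equivariant_injective_set rho1 rho2 phi :
  lift_equivariant rho1 rho2 phi ->
  exists K : set (circle R),
    [/\ K !=set0, forall g, rho2 g @` K = K & set_inj K phi].
Proof.
move=> [a [b [f [aP bP [fP f1 fle] ab]]]].
suff [L [[x0 Lx0] L_le Lb Linj]] : exists L : set R, [/\ L !=set0,
    forall x (n : int), L x -> L (x + n%:~R), forall g x, L x -> L (b g x) &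
    set_inj L f].
  exists (circle_pi @` L).
  have Lrho g z : (circle_pi @` L) z -> (circle_pi @` L) (rho2 g z).
    move=> [x Lx <-]; exists (b g x); first exact: Lb.
    by rewrite -bP Htilde_projE.
  split; first by exists (circle_pi x0), x0.
    move=> g; apply/seteqP; split=> [_ [z Kz <-]|z Kz]; first exact: Lrho.
    exists (rho2 g^-1%g z); first exact: Lrho.
    by rewrite -HomeoM -gmulfM mulgV action1.
  move=> _ _ /set_mem[x Lx <-] /set_mem[y Ly <-].
  rewrite -!fP => /circle_piP[n]; rewrite -add1_addz// => fxy.
  apply/circle_piP; exists n; apply: Linj fxy; apply/mem_set => //.
  exact: L_le.
have bK g x : b g ((b g)^-1%g x) = x by rewrite -HtildeM mulgV.
have fD x (n : int) : f (x + n%:~R) = f x + n%:~R by exact: add1_addz.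
have [|[x fx]|[x fx]] := fibre_extremum fle.
- by exists (0 + 1); rewrite f1; lra.
- exists [set x | forall z, x < z -> f x < f z]; split; first by exists x.
  + by move=> y n Ly z yz; rewrite fD -ltrBrDr -intrN -fD Ly// intrN ltrBrDr.
  + move=> g y Ly z; rewrite -(bK g z) Htilde_lt => /Ly.
    by rewrite -!ab Htilde_lt.
  + move=> y z /set_mem Ly /set_mem Lz fyz.
    by have [/Ly|/Lz|//] := ltgtP y z; rewrite fyz ltxx.
- exists [set x | forall z, z < x -> f z < f x]; split; first by exists x.
  + by move=> y n Ly z zy; rewrite fD -ltrBlDr -intrN -fD Ly// intrN ltrBlDr.
  + move=> g y Ly z; rewrite -(bK g z) Htilde_lt => /Ly.
    by rewrite -!ab Htilde_lt.
  + move=> y z /set_mem Ly /set_mem Lz fyz.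
    by have [/Lz|/Ly|//] := ltgtP y z; rewrite fyz ltxx.
Qed.

End semiconjugacy.

(** * The cycle of implications *)

Unset Implicit Arguments.

Theorem theorem1p4 (R : realType) (Gamma : groupType)
    (rho1 rho2 : {multiplicative Gamma -> Homeo_circle R})
    (C : set (circle R -> circle R))
    (hC : C = setT \/ C = usc_map \/ C = lsc_map) :
  [<-> (* i *)
       left_semiconjugate C rho1 rho2 /\ right_semiconjugate C rho1 rho2;
       (* ii *)
       [/\ ~ (exists x, global_fixed_point rho1 x),
           ~ (exists x, global_fixed_point rho2 x) &
           left_semiconjugate C rho1 rho2]
       \/ ((exists x, global_fixed_point rho1 x) /\
           (exists x, global_fixed_point rho2 x));
       (* iii *)
       exists phi, [/\ C phi, left_semiconjugacy rho1 rho2 phi &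
         exists K : set (circle R),
           [/\ K !=set0, forall g, rho2 g @` K = K & set_inj K phi]];
       (* iv *)
       exists phi, [/\ C phi, left_semiconjugacy rho1 rho2 phi &
         exists (lrho1 lrho2 : Gamma -> Htilde R) (lphi : R -> R),
           [/\ forall g, Htilde_proj (lrho1 g) = rho1 g,
               forall g, Htilde_proj (lrho2 g) = rho2 g,
               good_lift phi lphi &
               forall g x, lrho1 g (lphi x) = lphi (lrho2 g x)]];
       (* v *)
       bounded_euler_class rho1 = bounded_euler_class rho2].
Proof.
have constantP (phi : circle R -> circle R) :
    (exists x y, phi x <> phi y) \/ exists q, phi = fun=> q.
  have [|/forallNP const] := pselect (exists x y, phi x <> phi y); first by left.
  right; exists (phi (circle_pi 0)); apply/funext => x.
  by have /forallNP/(_ (circle_pi 0))/contrapT := const x.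
tfae.
- move=> [[phi [Cphi [d1 phiE]]] [psi [_ [_ psiE]]]].
  (* [psi] carries fixed points of [rho1] to fixed points of [rho2], and [phi] conversely. *)
  have [[x fx]|no1] := pselect (exists x, global_fixed_point rho1 x).
    right; split; first by exists x.
    by exists (psi x) => g; rewrite psiE fx.
  left; split=> //; last by exists phi.
  by move=> [x fx]; apply: no1; exists (phi x) => g; rewrite phiE fx.
(* An equivariant map of any regularity yields equal Euler classes, and these give back one in
   [C]. *)
- suff ii_lift : ([/\ ~ (exists x, global_fixed_point rho1 x),
           ~ (exists x, global_fixed_point rho2 x) &
           left_semiconjugate C rho1 rho2]
       \/ ((exists x, global_fixed_point rho1 x) /\
           (exists x, global_fixed_point rho2 x))) ->
      exists phi, lift_equivariant rho1 rho2 phi.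
    move=> /ii_lift[_ /lift_equivariant_euler_class eqe].
    have [phi [Cphi phiE]] := euler_class_lift_equivariant hC eqe.
    exists phi; split=> //; first exact: lift_equivariant_semiconjugacy.
    exact: lift_equivariant_injective_set phiE.
  move=> [[no1 _ [phi [_ semi]]]|[[q fq] [p fp]]]; last first.
    by exists (fun=> q); exact: lift_equivariant_of_constant fq fp.
  have [nonconst|[q phiq]] := constantP phi.
    by exists phi; exact: lift_equivariant_of_nonconstant.
  case: no1; exists q => g; have [_ /(_ g (circle_pi 0))] := semi.
  by rewrite phiq.
- move=> [phi [Cphi semi [K [[p Kp] Kinv Kinj]]]]; exists phi; split=> //.
  have [nonconst|[q phiq]] := constantP phi.
    exact: lift_equivariant_of_nonconstant.
  (* A constant map injective on [K] forces [K] to be a single point, which [rho2] fixes by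
     invariance. *)
  rewrite phiq; apply: (@lift_equivariant_of_constant _ _ _ _ p).
    by move=> g; have [_ /(_ g p)] := semi; rewrite phiq.
  move=> g; apply: Kinj; last by rewrite phiq.
    by apply/mem_set; rewrite -(Kinv g); exists p.
  exact/mem_set.
- by move=> [phi [_ _ /lift_equivariant_euler_class]].
- move=> eqe.
  have [phi [Cphi phiE]] := euler_class_lift_equivariant hC eqe.
  have [psi [Cpsi psiE]] := euler_class_lift_equivariant hC (esym eqe).
  by split; [exists phi|exists psi]; split=> //;
    exact: lift_equivariant_semiconjugacy.
Qed.
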